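(* Let $G$ be a graph and $(M,x)\in\mathcal{P}(G)$. If $G$ has an independent set $C$ such that $M[C]$ is diagonal and, with $c=\max_{u\in V(G)}\frac{(M)_{uu}}{x_u^2}$, one has $\frac{(M)_{vv}}{x_v^2}=c$ for all $v\in C$ and $c\,x_v=\sum_{u\in C}(M)_{vu}x_u^{-1}$ for all $v\notin C$, then $$\alpha(G)=\vartheta'(G)=|C|=F(M,x).$$
   Context: $\alpha(G)$ is the independence number. $\mathcal{P}(G)$ is the set of pairs $(M,x)$ with $M$ a real positive semidefinite matrix indexed by $V(G)$ and $x$ in the column space of $M$ with all entries nonzero, such that $(M)_{ij}x_ix_j\le0$ for all distinct nonadjacent $i,j$. $M[C]$ is the principal submatrix indexed by $C$. $F(M,x)=x^\top M^\#x\max_{u}\frac{(M)_{uu}}{x_u^2}$ with $M^\#$ the group inverse (unique $X$ with $MXM=M$, $XMX=X$, $MX=XM$). $\vartheta'(G)$ is the Schrijver theta function: the minimum largest eigenvalue over real symmetric matrices $A$ indexed by $V(G)$ with $(A)_{ij}\ge1$ whenever $i=j$ or $i,j$ are nonadjacent. *)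

(* Defs.v *)
From mathcomp Require Import all_boot all_order all_algebra.
From mathcomp Require Import boolp classical_sets reals.
Set Implicit Arguments.
Unset Strict Implicit.
Unset Printing Implicit Defensive.
Import Order.TTheory GRing.Theory Num.Theory.
Local Open Scope ring_scope.

Record sgraph (n : nat) := SGraph {
  adj :> rel 'I_n;
  adj_sym : symmetric adj;
  adj_irr : irreflexive adj }.

Definition independent n (G : sgraph n) (S : {set 'I_n}) : bool :=
  [forall u in S, forall v in S, ~~ G u v].

Definition indep_number n (G : sgraph n) : nat :=
  \max_(S : {set 'I_n} | independent G S) #|S|.

Definition psd (R : realType) n (M : 'M[R]_n) : Prop :=
  M^T = M /\ forall v : 'cV[R]_n, 0 <= (v^T *m M *m v) 0 0.

Definition in_colspace (R : realType) n (M : 'M[R]_n) (x : 'cV[R]_n) : Prop :=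
  exists y : 'cV[R]_n, x = M *m y.

Definition in_P (R : realType) n (G : sgraph n)
    (M : 'M[R]_n) (x : 'cV[R]_n) : Prop :=
  [/\ psd M, in_colspace M x, (forall u, x u 0 != 0)
    & forall i j : 'I_n, i != j -> ~~ G i j -> M i j * x i 0 * x j 0 <= 0].

Definition principal_submx (R : realType) n (M : 'M[R]_n) (C : {set 'I_n}) :
    'M[R]_#|C| :=
  mxsub (@enum_val _ (mem C)) (@enum_val _ (mem C)) M.

Definition is_group_inverse (R : realType) n (M X : 'M[R]_n) : Prop :=
  [/\ M *m X *m M = M, X *m M *m X = X & M *m X = X *m M].

(* The group inverse of M, with value 0 when M has none; a real symmetric
   matrix always has one. *)
Definition group_inv (R : realType) n (M : 'M[R]_n) : 'M[R]_n :=
  xget 0 [set X | is_group_inverse M X]%classic.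

Lemma group_inverse_unique (R : realType) n (M X Y : 'M[R]_n) :
  is_group_inverse M X -> is_group_inverse M Y -> X = Y.
Proof.
move=> [MXM XMX cX] [MYM YMY cY].
have eMXY : M *m X = M *m Y.
  have XMMY : X *m M *m (M *m Y) = M *m Y by rewrite -cX mulmxA MXM.
  by rewrite -XMMY cY -mulmxA (mulmxA M Y M) MYM cX.
by rewrite -XMX -mulmxA eMXY mulmxA -cX eMXY cY YMY.
Qed.

Lemma group_invE (R : realType) n (M X : 'M[R]_n) :
  is_group_inverse M X -> group_inv M = X.
Proof.
move=> hX; apply: (@group_inverse_unique R n M) => //.
exact: (@xgetI _ 0 [set Y | is_group_inverse M Y]%classic X hX).
Qed.

(* Starting from the term of vertex 0 makes this the maximum even for matrices
   with negative diagonal entries. *)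
Definition max_ratio (R : realType) n (M : 'M[R]_n.+1) (x : 'cV[R]_n.+1) : R :=
  \big[Num.max/M ord0 ord0 / x ord0 0 ^+ 2]_(u < n.+1) (M u u / x u 0 ^+ 2).

Definition F (R : realType) n (M : 'M[R]_n.+1) (x : 'cV[R]_n.+1) : R :=
  (x^T *m group_inv M *m x) 0 0 * max_ratio M x.

Definition largest_eigenvalue (R : realType) n (A : 'M[R]_n) (l : R) : Prop :=
  eigenvalue A l /\ forall m, eigenvalue A m -> m <= l.

Definition theta_feasible (R : realType) n (G : sgraph n) (A : 'M[R]_n) : Prop :=
  A^T = A /\ forall i j : 'I_n, (i == j) || ~~ G i j -> 1 <= A i j.

Definition is_schrijver_theta (R : realType) n (G : sgraph n) (t : R) : Prop :=
  (exists2 A : 'M[R]_n, theta_feasible G A & largest_eigenvalue A t) /\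
  (forall (A : 'M[R]_n) (l : R),
     theta_feasible G A -> largest_eigenvalue A l -> t <= l).

(* The default value 0 cannot be mistaken for a minimum when n > 0: a feasible
   matrix has trace at least n, so its largest eigenvalue is at least 1. *)
Definition schrijver_theta (R : realType) n (G : sgraph n) : R :=
  xget 0 [set t | is_schrijver_theta G t]%classic.

(* Main.v *)
(* Let [D = diag(1/x)] and [N = D M D]. The hypotheses on [C] say that
   [M z = c x] for [z = D 1_C], i.e. [N 1_C = c 1]. Since [z^T x = |C|], this
   gives [x^T M^# x = |C| / c]. Cauchy-Schwarz for [N] at [1_C] gives
   [J <= (|C|/c) N] in the semidefinite order, so that
   [|C| I + J - (|C|/c) N] is feasible for theta' with largest eigenvalue [|C|]
   (attained at [1_C]). Conversely, the Rayleigh quotient of any feasible matrix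
   at the indicator of an independent set [S] is at least [|S|]. *)
Require Import Defs.
From mathcomp Require Import all_boot all_order all_algebra.
From mathcomp Require Import boolp classical_sets reals.
From mathcomp Require Import spectral complex ring lra.
Set Implicit Arguments.
Unset Strict Implicit.
Unset Printing Implicit Defensive.
Import Order.TTheory GRing.Theory Num.Theory.
Local Open Scope ring_scope.
Local Open Scope sesquilinear_scope.

(* The spectral theorem is available over closed fields only, hence the detour
   through [R[i]]; the eigenvalues found there are real, so eigenvalues of [A]. *)
Lemma rayleigh_le (R : rcfType) n (A : 'M[R]_n) (l : R) :
  A^T = A -> (forall m, eigenvalue A m -> m <= l) ->
  forall v : 'cV[R]_n, (v^T *m A *m v) 0 0 <= l * (v^T *m v) 0 0.
Proof.
move=> Asym Al v; pose f : {rmorphism R -> R[i]} := real_complex R.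
pose B := map_mx f A.
have fconj x : (f x)^* = f x by rewrite conj_Creal ?complex_real.
have conjf p q (X : 'M[R]_(p, q)) : map_mx Num.conj (map_mx f X) = map_mx f X.
  by apply/matrixP=> i j; rewrite !mxE fconj.
have Bherm : B \is hermsymmx.
  apply/is_hermitianmxP; rewrite expr0 scale1r -map_trmx conjf.
  by rewrite map_trmx Asym.
have := hermitian_spectral_diag_real Bherm.
have := orthomx_spectralP (hermitian_normalmx Bherm).
have := spectral_unitarymx B.
set P := spectralmx B; set d := spectral_diag B => Puni BE dreal.
have Punit := unitarymx_unit Puni.
(* Row [i] of [P] is a left eigenvector of [B] for [d 0 i]; this value is real, hence the image of
   an eigenvalue of [A]. *)
have dl i : d 0 i <= f l.
  have /complex_realP[r dr] : d 0 i \is Num.real by exact: (mxOverP dreal).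
  rewrite dr [f l]/(l%:C)%C lecR; apply: Al.
  rewrite -(eigenvalue_map f); apply/eigenvalueP; exists (row i P).
    rewrite -/B -row_mul BE !mulmxA mulmxV // mul1mx row_mul row_diag_mx.
    by rewrite -scalemxAl -rowE dr.
  apply/eqP => /(congr1 (mulmx^~ (invmx P))); rewrite mul0mx -row_mul mulmxV //.
  by move/rowP/(_ i); rewrite !mxE eqxx => /eqP; rewrite oner_eq0.
(* In the coordinates [w] of [v] with respect to the unitary eigenbasis, both forms become weighted
   sums of the [|w_i|^2], compared term by term. *)
pose w := P *m map_mx f v.
have wE : (map_mx f v)^T *m P^t* = w^t*.
  by rewrite trmx_mul map_mxM; congr (_ *m _); rewrite map_trmx [RHS]conjf.
have fq : f ((v^T *m A *m v) 0 0) = \sum_i d 0 i * `|w i 0| ^+ 2.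
  have -> : f ((v^T *m A *m v) 0 0) = ((map_mx f v)^T *m B *m map_mx f v) 0 0.
    by rewrite map_trmx -!map_mxM [RHS]mxE.
  rewrite BE invmx_unitary // !mulmxA wE -mulmxA -/w mxE; apply: eq_bigr => i _.
  by rewrite mul_mx_diag !mxE normCK mulrC mulrA mulrC.
have fn : f ((v^T *m v) 0 0) = \sum_i `|w i 0| ^+ 2.
  have -> : f ((v^T *m v) 0 0) = ((map_mx f v)^T *m map_mx f v) 0 0.
    by rewrite map_trmx -!map_mxM [RHS]mxE.
  rewrite -[(map_mx f v)^T]mulmx1 -(mulVmx Punit) invmx_unitary //.
  rewrite !mulmxA wE -mulmxA -/w mxE; apply: eq_bigr => i _.
  by rewrite !mxE normCK mulrC.
suff : f ((v^T *m A *m v) 0 0) <= f (l * (v^T *m v) 0 0) by rewrite lecR.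
rewrite rmorphM fq fn mulr_sumr; apply: ler_sum => i _.
by rewrite ler_wpM2r // exprn_ge0.
Qed.

(** * Quadratic forms and the Cauchy-Schwarz inequality *)

Lemma qformE (R : pzRingType) n (M : 'M[R]_n) (u v : 'cV[R]_n) :
  (u^T *m M *m v) 0 0 = \sum_i \sum_j u i 0 * M i j * v j 0.
Proof.
rewrite mxE exchange_big; apply: eq_bigr => j _ /=.
by rewrite mxE mulr_suml; apply: eq_bigr => i _; rewrite mxE.
Qed.

Lemma qform_sym (R : comPzRingType) n (M : 'M[R]_n) (u v : 'cV[R]_n) :
  M^T = M -> (u^T *m M *m v) 0 0 = (v^T *m M *m u) 0 0.
Proof.
move=> Msym; rewrite -[in RHS]Msym -(trmxK u) -mulmxA -!trmx_mul.
by rewrite [RHS]mxE trmxK mulmxA.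
Qed.

Lemma qform_comb (R : comPzRingType) n (M : 'M[R]_n) (u v : 'cV[R]_n) (s : R) :
  M^T = M ->
  ((v + s *: u)^T *m M *m (v + s *: u)) 0 0 =
  (v^T *m M *m v) 0 0 + (u^T *m M *m v) 0 0 * s *+ 2
    + (u^T *m M *m u) 0 0 * s ^+ 2.
Proof.
move=> Msym; rewrite [(_ + _)^T]linearD /= [(_ *: _)^T]linearZ /=.
rewrite !mulmxDl !mulmxDr.
rewrite -!scalemxAl -!scalemxAr.
move: (qform_sym v u Msym).
move: (v^T *m M *m v) (v^T *m M *m u) (u^T *m M *m v) (u^T *m M *m u).
move=> X Y Z W; rewrite !mxE => ->; ring.
Qed.

(** The form at [v + s u] is a polynomial [a s^2 + 2 b s + d] that is nonnegative for every [s]; one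
    well-chosen [s] gives the inequality. *)
Lemma psd_cauchy (R : realType) n (M : 'M[R]_n) (u v : 'cV[R]_n) :
  psd M ->
  (u^T *m M *m v) 0 0 ^+ 2 <= (u^T *m M *m u) 0 0 * (v^T *m M *m v) 0 0.
Proof.
move=> [Msym Mpos]; have a0 := Mpos u; have d0 := Mpos v.
have q s := Mpos (v + s *: u).
have {}q s : 0 <= (v^T *m M *m v) 0 0 + (u^T *m M *m v) 0 0 * s *+ 2
    + (u^T *m M *m u) 0 0 * s ^+ 2 by rewrite -qform_comb.
move: ((u^T *m M *m u) 0 0) ((u^T *m M *m v) 0 0) ((v^T *m M *m v) 0 0) a0 d0 q.
move=> a b d; rewrite le_eqVlt => /predU1P[<-|a0] d0 q.
  have [->|b0] := eqVneq b 0; first by rewrite expr0n mul0r.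
  (* For [a = 0] and [b] nonzero the polynomial is affine, and this [s] gives it the value -1. *)
  have := q (- (d + 1) / (2 * b)).
  have -> : d + b * (- (d + 1) / (2 * b)) *+ 2
      + 0 * (- (d + 1) / (2 * b)) ^+ 2 = -1 by field.
  by rewrite oppr_ge0 ler10.
(* The minimum point of the parabola. *)
have := q (- b / a).
have -> : d + b * (- b / a) *+ 2 + a * (- b / a) ^+ 2 = (a * d - b ^+ 2) / a.
  by field; rewrite gt_eqF.
by rewrite pmulr_lge0 ?invr_gt0 // subr_ge0.
Qed.

(** * Existence of the group inverse *)

(** Over the reals, [w M M = 0] forces [(w M)(w M)^T = 0] and so [w M = 0]. Hence [M] and [M^2] have
    the same row space, [M = P M^2] for some [P], and [P M P^T] is the group inverse. *)
Lemma sym_group_inverse (R : realType) n (M : 'M[R]_n) :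
  M^T = M -> is_group_inverse M (group_inv M).
Proof.
move=> Msym.
have normz (w : 'rV[R]_n) : w *m w^T = 0 -> w = 0.
  move/matrixP/(_ 0 0); rewrite !mxE => /eqP.
  rewrite psumr_eq0 => [/allP w0|i _]; last by rewrite mxE -expr2 sqr_ge0.
  apply/rowP=> i; have := w0 i (mem_index_enum i).
  by rewrite !mxE -expr2 sqrf_eq0 => /eqP.
have /submxP[P MP] : (M <= M *m M)%MS.
  suff e : (kermx (M *m M) <= kermx M)%MS.
    rewrite -(geq_leqif (mxrank_leqif_sup (submxMl M M))).
    by have := mxrankS e; rewrite !mxrank_ker leq_sub2lE ?rank_leq_row.
  apply/rV_subP => w /sub_kermxP wMM; apply/sub_kermxP/normz.
  by rewrite trmx_mul Msym !mulmxA -(mulmxA w) wMM mul0mx.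
have MQ : M = M *m M *m P^T by rewrite -{1}Msym {1}MP !trmx_mul Msym.
have eqE : P *m M = M *m P^T by rewrite {1}MQ !mulmxA -(mulmxA P) -MP.
suff inv : is_group_inverse M (P *m M *m P^T) by rewrite (group_invE inv).
have MX : M *m (P *m M *m P^T) = P *m M.
  by rewrite eqE !mulmxA -MQ.
have XM : P *m M *m P^T *m M = P *m M.
  by rewrite -(mulmxA P) -eqE -!mulmxA -MP.
split; rewrite ?MX ?XM //; first by rewrite -mulmxA -MP.
by rewrite -[LHS]mulmxA MX -[RHS]mulmxA -eqE.
Qed.

(** * Indicator vectors and bounds on the theta function *)

Definition indicator (R : pzSemiRingType) n (S : {set 'I_n}) : 'cV[R]_n :=
  \col_i (i \in S)%:R.

Lemma card_indicator (R : pzSemiRingType) n (S : {set 'I_n}) :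
  #|S|%:R = \sum_i indicator R S i 0.
Proof.
rewrite -sum1_card natr_sum big_mkcond; apply: eq_bigr => i _.
by rewrite mxE; case: (i \in S).
Qed.

Lemma indicator_norm (R : pzSemiRingType) n (S : {set 'I_n}) :
  ((indicator R S)^T *m indicator R S) 0 0 = #|S|%:R.
Proof.
rewrite card_indicator mxE; apply: eq_bigr => i _.
by rewrite !mxE; case: (i \in S); rewrite ?mulr1 ?mulr0.
Qed.

(** Only a bound on Rayleigh quotients is asked of [l], so that the lemma serves both arbitrary
    feasible matrices and the explicit optimal one. *)
Lemma feasible_card_le (R : realType) n (G : sgraph n) (A : 'M[R]_n) (l : R)
    (S : {set 'I_n}) :
  theta_feasible G A ->
  (forall v : 'cV[R]_n, (v^T *m A *m v) 0 0 <= l * (v^T *m v) 0 0) ->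
  independent G S -> (0 < #|S|)%N -> #|S|%:R <= l.
Proof.
move=> [_ Age] Al /forall_inP Sind S0.
have S0R : 0 < #|S|%:R :> R by rewrite ltr0n.
rewrite -(ler_pM2r S0R) -[X in l * X]indicator_norm.
(* [|S|^2] is written as a double sum and compared entrywise with the form of [A]. *)
apply: le_trans (Al _); rewrite qformE card_indicator big_distrlr /=.
apply: ler_sum => i _; apply: ler_sum => j _; rewrite !mxE.
case: (boolP (i \in S)) => iS; last by rewrite !mul0r.
case: (boolP (j \in S)) => jS; last by rewrite !mulr0.
by rewrite !mul1r mulr1 Age // (forall_inP (Sind i iS) j jS) orbT.
Qed.

Lemma schrijver_thetaE (R : realType) n (G : sgraph n) (t : R) :
  is_schrijver_theta G t -> schrijver_theta R G = t.
Proof.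
move=> tG.
have [[A Af Al] Amin] : is_schrijver_theta G (schrijver_theta R G).
  exact: (@xgetI _ 0 [set t | is_schrijver_theta G t]%classic t).
have [[B Bf Bl] Bmin] := tG.
by apply/eqP; rewrite eq_le (Amin B) // (Bmin A).
Qed.

Lemma feasible_of_indicator_image (R : realType) n (G : sgraph n)
    (N : 'M[R]_n) (c : R) (C : {set 'I_n}) :
  psd N -> 0 < c -> (forall u, N u u <= c) ->
  (forall i j, i != j -> ~~ G i j -> N i j <= 0) ->
  N *m indicator R C = c *: const_mx 1 ->
  let A := #|C|%:R%:M + const_mx 1 - (#|C|%:R / c) *: N in
  [/\ theta_feasible G A,
      forall v : 'cV[R]_n, (v^T *m A *m v) 0 0 <= #|C|%:R * (v^T *m v) 0 0
    & A *m indicator R C = #|C|%:R *: indicator R C].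
Proof.
move=> Npsd c0 Ndiag Nnon NC A; set t : R := #|C|%:R.
have Nsym := Npsd.1.
have t0 : 0 <= t by rewrite ler0n.
have tc0 : 0 <= t / c by rewrite divr_ge0 // ltW.
pose one : 'cV[R]_n := const_mx 1.
have JE : const_mx 1 = one *m one^T.
  by apply/matrixP=> i j; rewrite !mxE big_ord1 !mxE mulr1.
have oneC : one^T *m indicator R C = t%:M.
  apply/matrixP=> i j; rewrite !ord1 mxE [RHS]mxE mulr1n /t card_indicator.
  by apply: eq_bigr => k _; rewrite !mxE mul1r.
have CN : (indicator R C)^T *m N = c *: one^T.
  by rewrite -{1}Nsym -trmx_mul NC linearZ.
split.
- split.
    apply/matrixP=> i j; rewrite !mxE eq_sym.
    by have /matrixP/(_ i j) := Nsym; rewrite mxE => ->.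
  (* A diagonal entry is [t + 1 - (t/c) N i i] with [N i i <= c]; a nonadjacent one is
     [1 - (t/c) N i j] with [N i j <= 0]. *)
  move=> i j; rewrite !mxE; have [<- _|ij /= Gij] := eqVneq i j.
    suff : t / c * N i i <= t by rewrite mulr1n -/t; lra.
    by rewrite mulrAC ler_pdivrMr // ler_wpM2l.
  suff : t / c * N i j <= 0 by rewrite mulr0n -/t; lra.
  by rewrite mulr_ge0_le0 // Nnon.
- move=> v; rewrite /A -/t JE !(mulmxBr, mulmxBl, mulmxDr, mulmxDl).
  rewrite mul_mx_scalar -!scalemxAr -!scalemxAl mulmxA.
  have -> : v^T *m one = (one^T *m v)^T by rewrite trmx_mul trmxK.
  (* Since [1_C^T N = c 1^T], this reads [(c a)^2 <= c t b] with [a = 1^T v] and [b = v^T N v], so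
     the [J] term [a^2] is at most [(t/c) b]. *)
  have := psd_cauchy (indicator R C) v Npsd.
  rewrite CN -!scalemxAl oneC -(mulmxA _ one^T v).
  move: (one^T *m v) (v^T *m N *m v) (v^T *m v) => a b d.
  rewrite !mxE big_ord1 !mxE mulr1n exprMn expr2 -!mulrA ler_pM2l // => ab.
  suff : a 0 0 * a 0 0 <= t / c * b 0 0 by lra.
  by rewrite mulrAC ler_pdivlMr // mulrC -expr2.
(* Both [J 1_C] and [(t/c) N 1_C] equal [t 1], so they cancel. *)
- rewrite /A -/t JE mulmxBl mulmxDl mul_scalar_mx -mulmxA oneC mul_mx_scalar.
  by rewrite -scalemxAl NC scalerA divfK ?gt_eqF // addrK.
Qed.

Lemma is_schrijver_theta_card (R : realType) n (G : sgraph n) (N : 'M[R]_n)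
    (c : R) (C : {set 'I_n}) :
  psd N -> 0 < c -> (forall u, N u u <= c) ->
  (forall i j, i != j -> ~~ G i j -> N i j <= 0) ->
  N *m indicator R C = c *: const_mx 1 ->
  independent G C -> (0 < #|C|)%N ->
  is_schrijver_theta G (#|C|%:R : R) /\ indep_number G = #|C|.
Proof.
move=> Npsd c0 Ndiag Nnon NC Cind C0.
have [Af Aq AC] := feasible_of_indicator_image Npsd c0 Ndiag Nnon NC.
set A := (A in theta_feasible G A) in Af Aq AC; split; last first.
  apply/eqP; rewrite eqn_leq; apply/andP; split; last first.
    exact: (@leq_bigmax_cond _ (independent G) (fun S => #|S|)).
  (* The matrix [A] that attains theta' also bounds every independent set by [|C|]. *)
  apply/bigop.bigmax_leqP => S Sind; case: (posnP #|S|) => [->//|S0].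
  by have := feasible_card_le Af Aq Sind S0; rewrite ler_nat.
split=> [|B l Bf [_ Bl]]; last first.
  exact: (feasible_card_le Bf (rayleigh_le Bf.1 Bl)).
exists A => //; split.
  (* Eigenvectors are row vectors here, hence the transposes and the use of symmetry. *)
  apply/eigenvalueP; exists (indicator R C)^T.
    by rewrite -{1}Af.1 -trmx_mul AC linearZ.
  have [u uC] := card_gt0P C0; apply/eqP => /rowP/(_ u).
  by rewrite !mxE uC => /eqP; rewrite oner_eq0.
move=> m /eigenvalueP[w wA w0].
have ww0 : 0 < (w *m w^T) 0 0.
  rewrite mxE; have [j wj] := rV0Pn w w0.
  rewrite (bigD1 j) //= ltr_pwDl // ?mxE -?expr2 ?exprn_even_gt0 //.
  by apply: sumr_ge0 => k _; rewrite mxE -expr2 sqr_ge0.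
have := Aq w^T; rewrite trmxK wA -scalemxAl mxE.
by rewrite ler_pM2r.
Qed.

(** * Rescaling [M] by the entries of [x], and the value of [F] *)

Theorem theorem5p3 (R : realType) (n : nat) (G : sgraph n.+1)
    (M : 'M[R]_n.+1) (x : 'cV[R]_n.+1) (hMx : in_P G M x)
    (C : {set 'I_n.+1}) (hC : independent G C)
    (hdiag : is_diag_mx (principal_submx M C))
    (hin : forall v, v \in C -> M v v / x v 0 ^+ 2 = max_ratio M x)
    (hout : forall v, v \notin C ->
       max_ratio M x * x v 0 = \sum_(u in C) M v u * (x u 0)^-1) :
  [/\ (indep_number G)%:R = schrijver_theta R G,
      schrijver_theta R G = #|C|%:R
    & #|C|%:R = F M x].
Proof.
have [Mpsd [y xE] x0 Mnon] := hMx; have Msym := Mpsd.1.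
rewrite /F; have ratio_le u : M u u / x u 0 ^+ 2 <= max_ratio M x.
  exact: le_bigmax.
move: (max_ratio M x) hin hout ratio_le => c hin hout ratio_le.
have x2 u : 0 < x u 0 ^+ 2 by rewrite exprn_even_gt0 ?x0.
have offdiag u v : u \in C -> v \in C -> u != v -> M u v = 0.
  move=> uC vC uv; have /is_diag_mxP := hdiag.
  move/(_ (enum_rank_in uC u) (enum_rank_in uC v)).
  rewrite mxE !enum_rankK_in //.
  apply; apply: contra uv => /eqP/val_inj e.
  by rewrite -(enum_rankK_in uC uC) e enum_rankK_in.
(* If [M ord0 ord0] vanished, Cauchy-Schwarz at [e] and [y] would give
   [x_0^2 = (e^T M y)^2 <= 0]. *)
have c0 : 0 < c.
  apply: lt_le_trans (ratio_le ord0); rewrite divr_gt0 //.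
  pose e : 'cV[R]_n.+1 := delta_mx ord0 0.
  have eM (w : 'cV[R]_n.+1) : (e^T *m w) 0 0 = w ord0 0.
    by rewrite trmx_delta -rowE mxE.
  have eMe : (e^T *m M *m e) 0 0 = M ord0 ord0 by rewrite -mulmxA eM -colE mxE.
  rewrite lt_neqAle -{2}eMe Mpsd.2 andbT; apply/eqP => M00.
  have := psd_cauchy e y Mpsd; rewrite eMe -M00 mul0r -mulmxA -xE eM.
  by rewrite leNgt x2.
pose z : 'cV[R]_n.+1 := \col_u ((u \in C)%:R / x u 0).
have Mz : M *m z = c *: x.
  apply/colP=> v; rewrite !mxE.
  have -> : \sum_u M v u * z u 0 = \sum_(u in C) M v u * (x u 0)^-1.
    rewrite [RHS]big_mkcond; apply: eq_bigr => u _; rewrite mxE.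
    by case: (u \in C); rewrite ?mul1r // mul0r mulr0.
  (* For [v] in [C], diagonality of [M[C]] leaves the single term [M v v / x_v = c x_v]. *)
  have [vC|vC] := boolP (v \in C); last by rewrite hout.
  rewrite (bigD1 v) //= big1 ?addr0 => [|u /andP[uC uv]].
    by rewrite -(hin v vC) expr2 invfM -!mulrA mulVf ?x0 // mulr1.
  by rewrite offdiag ?mul0r // eq_sym.
(* For empty [C], [hout] would give [c x_0 = 0]. *)
have C0 : (0 < #|C|)%N.
  rewrite lt0n cards_eq0; apply/eqP => Ce; have := hout ord0.
  rewrite Ce inE big_set0 => /(_ isT)/eqP.
  by rewrite mulf_eq0 gt_eqF ?(negPf (x0 _)).
pose D : 'M[R]_n.+1 := diag_mx (\row_u (x u 0)^-1).
have DE u v : (D *m M *m D) u v = M u v / (x u 0 * x v 0).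
  by rewrite mul_mx_diag mul_diag_mx !mxE invfM mulrCA mulrA.
have DC : D *m indicator R C = z.
  by apply/colP=> u; rewrite mul_diag_mx !mxE mulrC.
have Dx : D *m x = const_mx 1.
  by apply/colP=> u; rewrite mul_diag_mx !mxE mulVf.
have Npsd : psd (D *m M *m D).
  split=> [|v]; first by rewrite !trmx_mul tr_diag_mx Msym mulmxA.
  by have := Mpsd.2 (D *m v); rewrite trmx_mul tr_diag_mx !mulmxA.
have [|||tG ->] := @is_schrijver_theta_card R _ G _ c C Npsd c0 _ _ _ hC C0.
- by move=> u; rewrite DE -expr2.
- move=> i j ij Gij; rewrite DE.
  (* Written over a positive denominator, the sign condition of [in_P] appears in the numerator. *)
  have -> : M i j / (x i 0 * x j 0) =
      (M i j * x i 0 * x j 0) / (x i 0 ^+ 2 * x j 0 ^+ 2).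
    by field; rewrite !x0.
  by rewrite mulr_le0_ge0 ?Mnon // invr_ge0 mulr_ge0 // ltW.
- by rewrite -!mulmxA DC Mz -scalemxAr Dx.
rewrite (schrijver_thetaE tG); split=> //.
have [MXM _ _] := sym_group_inverse Msym.
(* With [x = c^-1 M z], the identity [M M^# M = M] gives [x^T M^# x = c^-2 z^T M z = c^-1 z^T x]. *)
have {1 2}-> : x = c^-1 *: (M *m z)
  by rewrite Mz scalerA mulVf ?gt_eqF // scale1r.
rewrite [(_ *: _)^T]linearZ /= trmx_mul Msym -!scalemxAl -!scalemxAr.
have -> : z^T *m M *m group_inv M *m (M *m z) = z^T *m (M *m z).
  rewrite mulmxA -[X in X *m z]mulmxA -[X in X *m z]mulmxA (mulmxA M) MXM.
  by rewrite mulmxA.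
rewrite Mz -scalemxAr.
have -> : z^T *m x = #|C|%:R%:M.
  apply/matrixP=> i j; rewrite !ord1 mxE [RHS]mxE mulr1n card_indicator.
  by apply: eq_bigr => u _; rewrite !mxE divfK.
by rewrite !mxE mulr1n; field; rewrite gt_eqF.
Qed.
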